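(* Let $g:[0,\infty)\to(0,\infty)$ be a positive increasing function. In the unbounded forecasting game Skeptic can force the event $$\sum_n\frac{v_n}{g(A_n)}<\infty\ \Rightarrow\ \sum_{k\le n}\frac{x_k-m_k}{\sqrt{g(A_k)}}\ \text{ converges (as } n\to\infty),$$ where $A_n=\sum_{k=1}^n v_k$.
   Context: Unbounded forecasting game: $\mathcal K_0=1$. For $n=1,2,\ldots$: Forecaster announces $m_n\in\mathbb R$ and $v_n>0$; Skeptic announces $M_n\in\mathbb R$ and $V_n\ge0$; Reality announces $x_n\in\mathbb R$; and $\mathcal K_n:=\mathcal K_{n-1}+M_n(x_n-m_n)+V_n((x_n-m_n)^2-v_n)$. All moves are public. A path is an infinite sequence $\xi=(m_1,v_1,x_1,m_2,v_2,x_2,\ldots)$ of allowed moves of Forecaster and Reality; $\Xi$ is the set of paths; an event is any subset of $\Xi$. A strategy $\mathcal P$ of Skeptic specifies his allowed move $(M_n,V_n)$ at each round $n$ as a function of $m_1,v_1,x_1,\ldots,m_{n-1},v_{n-1},x_{n-1},m_n,v_n$. Its capital process is $\mathcal K^{\mathcal P}_0=0$, $\mathcal K^{\mathcal P}_n=\mathcal K^{\mathcal P}_{n-1}+M_n(x_n-m_n)+V_n((x_n-m_n)^2-v_n)$ with $(M_n,V_n)$ given by $\mathcal P$. Skeptic can force an event $E$ if there is a strategy $\mathcal P$ such that $\mathcal K^{\mathcal P}_n(\xi)\ge-1$ for all $\xi\in\Xi$, $n\ge0$, and $\limsup_n\mathcal K^{\mathcal P}_n(\xi)=\infty$ for every $\xi\notin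 E$. For events, $E_1\Rightarrow E_2$ denotes $E_1^c\cup E_2$. ''Converges'' means converges to a finite real limit. *)

(* Defs.v *)
From Stdlib Require Import Reals List.
From Coquelicot Require Import Coquelicot.
Open Scope R_scope.

(* The moves of Forecaster and Reality in one round; [v > 0] is carried by
   the type [posreal]. *)
Record round : Type := Round { fm : R; fv : posreal; rx : R }.

(* Rounds are numbered from 0: [xi n] is round n + 1 of the game. *)
Definition path : Type := nat -> round.

Definition event : Type := path -> Prop.

Definition event_imp (E1 E2 : event) : event := fun xi => ~ E1 xi \/ E2 xi.

(* [P h m v] is Skeptic's move (M, V) after the complete rounds [h], in
   chronological order, and Forecaster's announcement of [m] and [v] in the
   current round. The number of the current round is [S (length h)]. *)
Definition strategy : Type := list round -> R -> posreal -> R * nonnegreal.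

Definition history (xi : path) (n : nat) : list round := map xi (seq 0 n).

(* Capital after n rounds, starting from 0 rather than from the game's
   initial capital 1; hence the lower bound -1 in [can_force]. *)
Fixpoint capital (P : strategy) (xi : path) (n : nat) : R :=
  match n with
  | O => 0
  | S k =>
      let m := fm (xi k) in
      let v := fv (xi k) in
      let x := rx (xi k) in
      let MV := P (history xi k) m v in
      capital P xi k + fst MV * (x - m) + snd MV * ((x - m) ^ 2 - v)
  end.

Definition can_force (E : event) : Prop :=
  exists P : strategy,
    (forall (xi : path) (n : nat), -1 <= capital P xi n) /\
    (forall xi : path, ~ E xi -> is_LimSup_seq (capital P xi) p_infty).

(* [cumvar xi n] is v_1 + ... + v_(n+1): [sum_n a n] has n + 1 terms. *)
Definition cumvar (xi : path) (n : nat) : R :=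
  sum_n (fun k => pos (fv (xi k))) n.

(* Main.v *)
Require Import Defs.
From Stdlib Require Import Reals List.
From Coquelicot Require Import Coquelicot.
From Stdlib Require Import Arith Lra Lia Classical.
Open Scope R_scope.

(** The growth function only enters through the stakes [1 / sqrt (g A_n)],
    which are fixed before [x_n] is seen.  For any such stakes [a_n], put
    [y_n = a_n (x_n - m_n)], [w_n = a_n^2 v_n]; the claim is that Skeptic can
    force the sum of the [y_n] to converge when the sum of the [w_n] is finite.

    Skeptic follows the deviation [D] of the sum of the [y_n] from a reference
    point, and moves the reference point to the current value as soon as [|D|]
    reaches a threshold [eps].  Betting [2 D a_n] on [x_n - m_n] and [a_n^2] on
    [(x_n - m_n)^2 - v_n] changes the capital by [(D + y_n)^2 - D^2 - w_n].  The
    capital is therefore [Q + D^2 - W]: [Q] collects the squares of the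
    deviations abandoned at the resets, and [W] is the sum of the [w_n] so far.
    Since [w_n] is known before the bet on round [n] is placed, Skeptic can sit
    out every round that would carry [W] above a limit [C], and then never loses
    more than [C].  If the sum of the [w_n] is at most [C], and the sum of the
    [y_n] oscillates by at least [2 eps] arbitrarily late, then there are
    infinitely many resets ([reset_after]), each adding at least [eps^2] to [Q],
    and the capital tends to infinity ([realized_unbounded]).

    It remains to combine the thresholds [eps = 1 / (i + 1)] and limits
    [C = i + 1] for all [i].  The [i]-th account receives the initial capital
    [2^-(i+1)], and opens only in round [i], so that each move is a finite sum
    ([capital_mixture]). *)

(** * Finite sums *)

(** Capital after [n] rounds involves the rounds [k < n], hence the strict
    upper limit, unlike [sum_n]. *)
Fixpoint sum_below (u : nat -> R) (n : nat) : R :=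
  match n with
  | O => 0
  | S k => sum_below u k + u k
  end.

Lemma sum_below_S (u : nat -> R) (n : nat) : sum_below u (S n) = sum_n u n.
Proof.
  induction n as [|n IH].
  - rewrite sum_O. simpl. ring.
  - rewrite sum_Sn, <- IH. reflexivity.
Qed.

Lemma sum_below_ext (u u' : nat -> R) (n : nat) :
  (forall k, (k < n)%nat -> u k = u' k) -> sum_below u n = sum_below u' n.
Proof.
  induction n as [|n IH]; intros H; simpl; [reflexivity|].
  rewrite IH, H by auto with arith. reflexivity.
Qed.

Lemma sum_below_zero (u : nat -> R) (n : nat) :
  (forall k, (k < n)%nat -> u k = 0) -> sum_below u n = 0.
Proof.
  induction n as [|n IH]; intros H; simpl; [reflexivity|].
  rewrite IH, H by auto with arith. ring.
Qed.

Lemma sum_below_le (u u' : nat -> R) (n : nat) :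
  (forall k, u k <= u' k) -> sum_below u n <= sum_below u' n.
Proof.
  intros H; induction n as [|n IH]; simpl; [lra|]. specialize (H n). lra.
Qed.

Lemma sum_below_nonneg (u : nat -> R) (n : nat) :
  (forall k, 0 <= u k) -> 0 <= sum_below u n.
Proof.
  intros H; induction n as [|n IH]; simpl; [lra|]. specialize (H n). lra.
Qed.

Lemma sum_below_ge_term (u : nat -> R) (i n : nat) :
  (forall k, 0 <= u k) -> (i < n)%nat -> u i <= sum_below u n.
Proof.
  intros H; induction n as [|n IH]; intros Hi; [lia|]; simpl.
  destruct (Nat.eq_dec i n) as [->|Hne].
  - pose proof (sum_below_nonneg u n H). lra.
  - assert (u i <= sum_below u n) by (apply IH; lia). specialize (H n). lra.
Qed.

Lemma sum_below_linear (f p q : nat -> R) (X Y : R) (n : nat) :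
  sum_below (fun i => f i + p i * X + q i * Y) n =
  sum_below f n + sum_below p n * X + sum_below q n * Y.
Proof. induction n as [|n IH]; simpl; [ring|]. rewrite IH. ring. Qed.

Lemma sum_below_half_pow (n : nat) :
  sum_below (fun i => (1 / 2) ^ S i) n = 1 - (1 / 2) ^ n.
Proof. induction n as [|n IH]; simpl in *; [ring|]. rewrite IH. field. Qed.

Lemma sum_below_bounded (u : nat -> R) :
  (forall k, 0 <= u k) -> ex_series u ->
  exists B, forall n, sum_below u n <= B.
Proof.
  intros Hu [B HB]. exists B. intros n.
  assert (Hn : sum_n u n <= B).
  { apply (is_lim_seq_incr_compare (sum_n u)); [exact HB|].
    intros k. rewrite sum_Sn. unfold plus; simpl. specialize (Hu (S k)). lra. }
  rewrite <- sum_below_S in Hn. simpl in Hn. specialize (Hu n). lra.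
Qed.

(** * Deviations with resets *)

Fixpoint dev (eps : R) (y : nat -> R) (n : nat) : R :=
  match n with
  | O => 0
  | S k =>
      let d := dev eps y k + y k in
      if Rle_dec eps (Rabs d) then 0 else d
  end.

Fixpoint realized (eps : R) (y : nat -> R) (n : nat) : R :=
  match n with
  | O => 0
  | S k =>
      let d := dev eps y k + y k in
      realized eps y k + (if Rle_dec eps (Rabs d) then d ^ 2 else 0)
  end.

Lemma dev_ext (eps : R) (y y' : nat -> R) (n : nat) :
  (forall k, (k < n)%nat -> y k = y' k) -> dev eps y n = dev eps y' n.
Proof.
  induction n as [|n IH]; intros H; simpl; [reflexivity|].
  rewrite IH, H by auto with arith. reflexivity.
Qed.

Lemma dev_lt (eps : R) (y : nat -> R) (n : nat) :
  0 < eps -> Rabs (dev eps y n) < eps.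
Proof.
  intros He; destruct n as [|n]; simpl; [rewrite Rabs_R0; lra|].
  destruct (Rle_dec _ _); [rewrite Rabs_R0; lra|lra].
Qed.

(** A reset moves the square of the deviation from [dev] to [realized], so the
    total grows as it would without resets. *)
Lemma realized_dev_step (eps : R) (y : nat -> R) (n : nat) :
  realized eps y (S n) + dev eps y (S n) ^ 2 =
  realized eps y n + (dev eps y n + y n) ^ 2.
Proof. simpl. destruct (Rle_dec _ _); ring. Qed.

Lemma realized_le_S (eps : R) (y : nat -> R) (n : nat) :
  realized eps y n <= realized eps y (S n).
Proof.
  simpl. destruct (Rle_dec _ _); [|lra].
  pose proof (pow2_ge_0 (dev eps y n + y n)). simpl in *. lra.
Qed.

Lemma realized_mono (eps : R) (y : nat -> R) (n k : nat) :
  (n <= k)%nat -> realized eps y n <= realized eps y k.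
Proof.
  induction 1 as [|k _ IH]; [lra|].
  pose proof (realized_le_S eps y k). lra.
Qed.

Lemma realized_nonneg (eps : R) (y : nat -> R) (n : nat) :
  0 <= realized eps y n.
Proof. exact (realized_mono eps y 0 n (Nat.le_0_l n)). Qed.

Lemma dev_realized_zero (eps : R) (y : nat -> R) (n : nat) :
  0 < eps -> (forall k, (k < n)%nat -> y k = 0) ->
  dev eps y n = 0 /\ realized eps y n = 0.
Proof.
  intros He; induction n as [|n IH]; intros H; simpl; [auto|].
  destruct IH as [-> ->]; [auto with arith|].
  rewrite H, Rplus_0_l, Rabs_R0 by lia.
  destruct (Rle_dec _ _); split; lra.
Qed.

(** Without a reset from [n0] on, deviations follow the partial sums up to an
    additive constant; as they stay below [eps] in absolute value, the partial
    sums could not oscillate by [2 eps]. *)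
Lemma reset_after (eps : R) (y : nat -> R) (n0 : nat) :
  0 < eps ->
  (exists n k, (n0 <= n)%nat /\ (n0 <= k)%nat /\
     2 * eps <= Rabs (sum_below y n - sum_below y k)) ->
  exists n, (n0 <= n)%nat /\ eps <= Rabs (dev eps y n + y n).
Proof.
  intros He (n & k & Hn & Hk & Hosc).
  apply NNPP; intros Hno.
  assert (Hfollow : forall l, (n0 <= l)%nat ->
            dev eps y l - dev eps y n0 = sum_below y l - sum_below y n0).
  { induction 1 as [|l Hl IH]; [ring|]. simpl.
    destruct (Rle_dec _ _) as [Hr|_]; [|lra].
    exfalso; apply Hno; exists l; auto. }
  pose proof (Hfollow n Hn). pose proof (Hfollow k Hk).
  pose proof (Rabs_def2 _ _ (dev_lt eps y n He)).
  pose proof (Rabs_def2 _ _ (dev_lt eps y k He)).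
  assert (Rabs (sum_below y n - sum_below y k) < 2 * eps)
    by (apply Rabs_def1; lra).
  lra.
Qed.

Lemma realized_unbounded (eps : R) (y : nat -> R) :
  0 < eps ->
  (forall n0, exists n k, (n0 <= n)%nat /\ (n0 <= k)%nat /\
     2 * eps <= Rabs (sum_below y n - sum_below y k)) ->
  forall B, exists n0, forall n, (n0 <= n)%nat -> B <= realized eps y n.
Proof.
  intros He Hosc.
  assert (Hcount : forall N, exists n, INR N * eps ^ 2 <= realized eps y n).
  { induction N as [|N [n Hn]]; [exists 0%nat; simpl; lra|].
    destruct (reset_after eps y n He (Hosc n)) as (k & Hk & Hr).
    exists (S k). pose proof (realized_mono eps y n k Hk).
    rewrite S_INR. simpl realized.
    destruct (Rle_dec _ _) as [_|C]; [|contradiction].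
    assert (eps ^ 2 <= (dev eps y k + y k) ^ 2).
    { rewrite <- (pow2_abs (dev eps y k + y k)). apply pow_incr; lra. }
    lra. }
  intros B.
  assert (He2 : 0 < eps ^ 2) by (apply pow_lt; lra).
  destruct (nfloor_ex (Rabs B / eps ^ 2)) as [N HN].
  { apply Rdiv_le_0_compat; [apply Rabs_pos|lra]. }
  destruct (Hcount (S N)) as [n0 Hn0]. exists n0. intros n Hn.
  pose proof (realized_mono eps y n0 n Hn).
  rewrite S_INR in Hn0.
  assert (Rabs B <= (INR N + 1) * eps ^ 2)
    by (apply Rle_div_l; [exact He2|lra]).
  pose proof (Rle_abs B). lra.
Qed.

(** * Predictable processes *)

Definition agree_before (xi xi' : path) (n : nat) : Prop :=
  (forall k, (k < n)%nat -> xi k = xi' k) /\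
  fm (xi n) = fm (xi' n) /\ fv (xi n) = fv (xi' n).

Definition predictable (X : path -> nat -> R) : Prop :=
  forall xi xi' n, agree_before xi xi' n -> X xi n = X xi' n.

Lemma agree_before_le (xi xi' : path) (k n : nat) :
  (k <= n)%nat -> agree_before xi xi' n -> agree_before xi xi' k.
Proof.
  intros Hk (H & Hm & Hv).
  destruct (Nat.eq_dec k n) as [->|Hne]; [repeat split; assumption|].
  split; [intros l Hl; apply H; lia|].
  rewrite (H k) by lia. auto.
Qed.

(** Processes on paths are easier to handle than functions of finite
    histories; a predictable process can be played because its value does not
    change when the current history is completed to a path by arbitrary later
    moves. *)
Lemma predictable_strategy (M V : path -> nat -> R) :
  predictable M -> predictable V -> (forall xi n, 0 <= V xi n) ->
  exists P : strategy, forall xi n,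
    capital P xi (S n) =
    capital P xi n + M xi n * (rx (xi n) - fm (xi n))
    + V xi n * ((rx (xi n) - fm (xi n)) ^ 2 - fv (xi n)).
Proof.
  intros HM HV Vpos.
  pose (completed := fun (h : list round) m v k => nth k h (Round m v 0)).
  exists (fun h m v =>
            (M (completed h m v) (length h),
             mknonnegreal (V (completed h m v) (length h)) (Vpos _ _))).
  intros xi n. simpl.
  assert (Hlen : length (history xi n) = n)
    by (unfold history; now rewrite length_map, length_seq).
  assert (Hag : agree_before
            (completed (history xi n) (fm (xi n)) (fv (xi n))) xi n).
  { split.
    - intros k Hk. unfold completed.
      rewrite (nth_indep _ _ (xi 0%nat)) by (rewrite Hlen; exact Hk).
      unfold history. rewrite map_nth, seq_nth by exact Hk. reflexivity.
    - unfold completed. rewrite nth_overflow by (rewrite Hlen; lia). auto. }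
  rewrite Hlen, (HM _ _ _ Hag), (HV _ _ _ Hag). reflexivity.
Qed.

(** * A single account *)

Definition gain (b : path -> nat -> R) (xi : path) (k : nat) : R :=
  b xi k * (rx (xi k) - fm (xi k)).

Definition variance (b : path -> nat -> R) (xi : path) (k : nat) : R :=
  b xi k ^ 2 * fv (xi k).

Lemma variance_nonneg (b : path -> nat -> R) (xi : path) (k : nat) :
  0 <= variance b xi k.
Proof.
  unfold variance. pose proof (cond_pos (fv (xi k))).
  apply Rmult_le_pos; [apply pow2_ge_0|lra].
Qed.

Lemma predictable_variance_sum (b : path -> nat -> R) :
  predictable b -> predictable (fun xi n => sum_below (variance b xi) (S n)).
Proof.
  intros Hb xi xi' n H. apply sum_below_ext. intros k Hk.
  destruct (agree_before_le xi xi' k n ltac:(lia) H) as (H1 & H2 & H3).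
  unfold variance. rewrite H3, (Hb xi xi' k); [reflexivity|].
  repeat split; assumption.
Qed.

Lemma predictable_dev (eps : R) (b : path -> nat -> R) :
  predictable b -> predictable (fun xi n => dev eps (gain b xi) n).
Proof.
  intros Hb xi xi' n H. apply dev_ext. intros k Hk.
  unfold gain. rewrite (Hb xi xi' k).
  - rewrite (proj1 H k Hk). reflexivity.
  - apply (agree_before_le xi xi' k n); [lia|exact H].
Qed.

Definition balance (eps : R) (b : path -> nat -> R) (xi : path) (n : nat) : R :=
  realized eps (gain b xi) n + dev eps (gain b xi) n ^ 2
  - sum_below (variance b xi) n.

Lemma balance_step (eps : R) (b : path -> nat -> R) (xi : path) (n : nat) :
  balance eps b xi (S n) =
  balance eps b xi n
  + 2 * dev eps (gain b xi) n * b xi n * (rx (xi n) - fm (xi n))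
  + b xi n ^ 2 * ((rx (xi n) - fm (xi n)) ^ 2 - fv (xi n)).
Proof.
  unfold balance. rewrite realized_dev_step. simpl sum_below.
  unfold variance at 2, gain at 3. ring.
Qed.

(** The test on the accumulated variance includes round [n] itself, so that
    the limit is never exceeded. *)
Definition limited (a : path -> nat -> R) (i : nat) (C : R)
    (xi : path) (n : nat) : R :=
  if le_dec i n then
    if Rle_dec (sum_below (variance a xi) (S n)) C then a xi n else 0
  else 0.

Lemma predictable_limited (a : path -> nat -> R) (i : nat) (C : R) :
  predictable a -> predictable (limited a i C).
Proof.
  intros Ha xi xi' n H. unfold limited.
  rewrite (Ha xi xi' n H), (predictable_variance_sum a Ha xi xi' n H).
  reflexivity.
Qed.

Lemma limited_variance_le (a : path -> nat -> R) (i : nat) (C : R)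
    (xi : path) (n : nat) :
  0 <= C -> sum_below (variance (limited a i C) xi) n <= C.
Proof.
  intros HC.
  assert (Hle : forall k, variance (limited a i C) xi k <= variance a xi k).
  { intros k. pose proof (variance_nonneg a xi k).
    unfold variance, limited in *.
    destruct (le_dec i k); [destruct (Rle_dec _ C)|]; lra. }
  induction n as [|n IH]; [exact HC|].
  destruct (Rle_dec (sum_below (variance a xi) (S n)) C) as [Hn|Hn].
  - pose proof (sum_below_le _ _ (S n) Hle). lra.
  - simpl.
    assert (Hz : variance (limited a i C) xi n = 0).
    { unfold variance, limited.
      destruct (le_dec i n); [destruct (Rle_dec _ C); [contradiction|]|]; ring. }
    lra.
Qed.

(** * The mixture of accounts *)

Section Mixture.

Variable a : path -> nat -> R.
Hypothesis a_pred : predictable a.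

Let C (i : nat) : R := INR i + 1.
Let eps (i : nat) : R := / C i.
Let b (i : nat) : path -> nat -> R := limited a i (C i).
Let weight (i : nat) : R := (1 / 2) ^ S i / C i.

Let C_pos (i : nat) : 0 < C i.
Proof. unfold C. pose proof (pos_INR i). lra. Qed.

Let eps_pos (i : nat) : 0 < eps i.
Proof. apply Rinv_0_lt_compat, C_pos. Qed.

Let weight_pos (i : nat) : 0 < weight i.
Proof. apply Rdiv_lt_0_compat; [apply pow_lt; lra|apply C_pos]. Qed.

Lemma balance_opening (i : nat) (xi : path) : balance (eps i) (b i) xi i = 0.
Proof.
  assert (Hb : forall k, (k < i)%nat -> b i xi k = 0).
  { intros k Hk. unfold b, limited. destruct (le_dec i k); [lia|reflexivity]. }
  destruct (dev_realized_zero (eps i) (gain (b i) xi) i (eps_pos i))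
    as [Hd Hr].
  { intros k Hk. unfold gain. rewrite Hb by exact Hk. ring. }
  unfold balance. rewrite Hd, Hr.
  rewrite sum_below_zero; [ring|].
  intros k Hk. unfold variance. rewrite Hb by exact Hk. ring.
Qed.

Lemma capital_mixture :
  exists P : strategy, forall xi n,
    capital P xi n =
    sum_below (fun i => weight i * balance (eps i) (b i) xi n) n.
Proof.
  destruct (predictable_strategy
    (fun xi n => sum_below (fun i =>
       weight i * (2 * dev (eps i) (gain (b i) xi) n * b i xi n)) (S n))
    (fun xi n => sum_below (fun i => weight i * b i xi n ^ 2) (S n)))
    as [P HP].
  - intros xi xi' n H. apply sum_below_ext. intros i _.
    rewrite (predictable_limited a i (C i) a_pred xi xi' n H : b i xi n = _).
    rewrite (predictable_dev (eps i) (b i)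
               (predictable_limited a i (C i) a_pred) xi xi' n H).
    reflexivity.
  - intros xi xi' n H. apply sum_below_ext. intros i _.
    rewrite (predictable_limited a i (C i) a_pred xi xi' n H : b i xi n = _).
    reflexivity.
  - intros xi n. apply sum_below_nonneg. intros i.
    apply Rmult_le_pos; [left; apply weight_pos|apply pow2_ge_0].
  - exists P. intros xi. induction n as [|n IH]; [reflexivity|].
    rewrite HP, IH.
    (* Account [n] is opened in this round, with balance 0. *)
    assert (Hopen :
      sum_below (fun i => weight i * balance (eps i) (b i) xi n) n =
      sum_below (fun i => weight i * balance (eps i) (b i) xi n) (S n)).
    { simpl. rewrite balance_opening. ring. }
    rewrite Hopen, <- sum_below_linear. apply sum_below_ext. intros i _.
    rewrite balance_step. ring.
Qed.

(** The initial capital [2^-(i+1)] of account [i] covers its largest possible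
    loss [weight i * C i]. *)
Lemma account_ge_realized (i : nat) (xi : path) (n : nat) :
  weight i * realized (eps i) (gain (b i) xi) n <=
  weight i * balance (eps i) (b i) xi n + (1 / 2) ^ S i.
Proof.
  assert (Hc : (1 / 2) ^ S i = weight i * C i).
  { unfold weight. field. pose proof (C_pos i). lra. }
  rewrite Hc, <- Rmult_plus_distr_l.
  apply Rmult_le_compat_l; [left; apply weight_pos|].
  pose proof (limited_variance_le a i (C i) xi n (Rlt_le _ _ (C_pos i))).
  pose proof (pow2_ge_0 (dev (eps i) (gain (b i) xi) n)).
  unfold balance, b in *. lra.
Qed.

Lemma mixture_bounds (xi : path) (n : nat) :
  let K := sum_below (fun i => weight i * balance (eps i) (b i) xi n) n in
  -1 <= K /\
  forall i, (i < n)%nat ->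
    weight i * realized (eps i) (gain (b i) xi) n - 1 <= K.
Proof.
  intros K.
  pose (net := fun i =>
    weight i * balance (eps i) (b i) xi n + (1 / 2) ^ S i).
  assert (Hnet : sum_below net n <= K + 1).
  { pose proof (sum_below_linear
      (fun i => weight i * balance (eps i) (b i) xi n)
      (fun i => (1 / 2) ^ S i) (fun _ => 0) 1 0 n) as Hlin.
    rewrite (sum_below_ext _ net), sum_below_half_pow in Hlin
      by (intros; unfold net; ring).
    assert (0 < (1 / 2) ^ n) by (apply pow_lt; lra).
    unfold K. lra. }
  assert (Hpos : forall i, 0 <= net i).
  { intros i. eapply Rle_trans; [|apply account_ge_realized].
    apply Rmult_le_pos; [left; apply weight_pos|apply realized_nonneg]. }
  split.
  - pose proof (sum_below_nonneg net n Hpos). lra.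
  - intros i Hi. pose proof (sum_below_ge_term net i n Hpos Hi).
    pose proof (account_ge_realized i xi n). unfold net in *. lra.
Qed.

(** One index [i] serves both purposes: it is so large that the variance never
    exceeds the limit [C i], and that [2 eps i] is at most the size of the
    oscillation. *)
Lemma diverging_account (xi : path) :
  ex_series (variance a xi) ->
  ~ ex_finite_lim_seq (sum_n (gain a xi)) ->
  exists i, forall B, exists n0, forall n,
    (n0 <= n)%nat -> B <= realized (eps i) (gain (b i) xi) n.
Proof.
  intros Hser Hdiv.
  destruct (sum_below_bounded _ (variance_nonneg a xi) Hser) as [W HW].
  assert (Hosc : exists d, 0 < d /\ forall n0, exists n k,
            (n0 <= n)%nat /\ (n0 <= k)%nat /\
            d <= Rabs (sum_n (gain a xi) n - sum_n (gain a xi) k)).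
  { apply NNPP; intros Hno. apply Hdiv, ex_lim_seq_cauchy_corr.
    intros d. apply NNPP; intros Hd. apply Hno.
    exists d. split; [apply cond_pos|]. intros n0.
    apply NNPP; intros Hn0. apply Hd. exists n0. intros n k Hn Hk.
    apply Rnot_le_lt; intros Hle. apply Hn0. exists n, k. auto. }
  destruct Hosc as (d & Hd & Hosc).
  destruct (nfloor_ex (Rmax (Rabs W) (2 / d))) as [i [_ Hi]].
  { eapply Rle_trans; [apply Rabs_pos|apply Rmax_l]. }
  assert (HWi : W <= C i).
  { unfold C. pose proof (Rle_abs W).
    pose proof (Rmax_l (Rabs W) (2 / d)). lra. }
  assert (Hdi : 2 * eps i <= d).
  { unfold eps. pose proof (C_pos i).
    apply Rle_div_l; [lra|].
    pose proof (Rmax_r (Rabs W) (2 / d)).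
    rewrite Rmult_comm. apply Rle_div_l; [lra|]. unfold C. lra. }
  exists i. apply realized_unbounded; [apply eps_pos|]. intros n0.
  (* As the limit is never exceeded, account [i] bets in every round once it is
     open. *)
  assert (Hb : forall k, (i <= k)%nat -> gain (b i) xi k = gain a xi k).
  { intros k Hk. unfold gain, b, limited.
    destruct (le_dec i k); [|lia].
    destruct (Rle_dec _ _) as [_|Hc]; [reflexivity|].
    exfalso; apply Hc. specialize (HW (S k)). lra. }
  assert (Hshift : forall k, (i <= k)%nat ->
            sum_below (gain (b i) xi) k - sum_below (gain a xi) k =
            sum_below (gain (b i) xi) i - sum_below (gain a xi) i).
  { induction 1 as [|k Hk IH]; [reflexivity|].
    simpl. rewrite (Hb k Hk). lra. }
  destruct (Hosc (Nat.max i n0)) as (n & k & Hn & Hk & Hnk).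
  exists (S n), (S k). split; [lia|]. split; [lia|].
  rewrite <- !sum_below_S in Hnk.
  pose proof (Hshift (S n) ltac:(lia)). pose proof (Hshift (S k) ltac:(lia)).
  replace (sum_below (gain (b i) xi) (S n) - sum_below (gain (b i) xi) (S k))
    with (sum_below (gain a xi) (S n) - sum_below (gain a xi) (S k)) by lra.
  lra.
Qed.

Lemma can_force_variance_convergence :
  can_force
    (event_imp (fun xi => ex_series (variance a xi))
       (fun xi => ex_finite_lim_seq (sum_n (gain a xi)))).
Proof.
  destruct capital_mixture as [P HP]. exists P. split.
  - intros xi n. rewrite HP. apply mixture_bounds.
  - intros xi HE. unfold event_imp in HE.
    destruct (diverging_account xi) as [i Hi]; [apply NNPP; tauto|tauto|].
    intros B N.
    destruct (Hi ((B + 2) / weight i)) as [n0 Hn0].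
    pose (n := Nat.max (S i) (Nat.max N n0)).
    exists n. split; [unfold n; lia|]. rewrite HP.
    pose proof (proj2 (mixture_bounds xi n) i ltac:(unfold n; lia)).
    specialize (Hn0 n ltac:(unfold n; lia)).
    apply Rle_div_l in Hn0; [lra|apply weight_pos].
Qed.

End Mixture.

(** * Normalization by the growth function *)

Lemma can_force_mono (E E' : event) :
  (forall xi, E xi -> E' xi) -> can_force E -> can_force E'.
Proof. intros H [P [Hlow Hsup]]. exists P. split; auto. Qed.

Lemma predictable_cumvar : predictable cumvar.
Proof.
  intros xi xi' n H. apply sum_n_ext_loc. intros k Hk.
  destruct (agree_before_le xi xi' k n Hk H) as (_ & _ & Hv).
  now rewrite Hv.
Qed.

Lemma cumvar_nonneg (xi : path) (n : nat) : 0 <= cumvar xi n.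
Proof.
  unfold cumvar. rewrite <- sum_below_S. apply sum_below_nonneg.
  intros k. left; apply cond_pos.
Qed.

Theorem theorem4p4 (g : R -> R)
  (g_pos : forall t : R, 0 <= t -> 0 < g t)
  (g_incr : forall s t : R, 0 <= s -> s <= t -> g s <= g t) :
  can_force
    (event_imp
       (fun xi : path =>
          ex_series (fun n : nat => fv (xi n) / g (cumvar xi n)))
       (fun xi : path =>
          ex_finite_lim_seq
            (sum_n (fun k : nat =>
               (rx (xi k) - fm (xi k)) / sqrt (g (cumvar xi k)))))).
Proof.
  pose (a := fun (xi : path) n => / sqrt (g (cumvar xi n))).
  apply can_force_mono with
    (2 := can_force_variance_convergence a
            (fun xi xi' n H => f_equal (fun t => / sqrt (g t))
                                 (predictable_cumvar xi xi' n H))).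
  intros xi [Hdiv | [l Hl]]; [left | right].
  - intros Hser. apply Hdiv. revert Hser. apply ex_series_ext. intros n.
    pose proof (g_pos _ (cumvar_nonneg xi n)) as Hg.
    unfold variance, a, Rdiv. rewrite pow_inv, pow2_sqrt by lra.
    apply Rmult_comm.
  - exists l. revert Hl. apply is_lim_seq_ext. intros n. apply sum_n_ext.
    intros k. unfold gain, a, Rdiv. apply Rmult_comm.
Qed.
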